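(* Let $\mu$ be a probability measure on $X=L^2(D)$ with $\int_X\|u\|_{L^2}^2\,d\mu(u)<\infty$ and $\int_X u\,d\mu(u)=0$. If $\mathcal{E}:X\to\mathbb{R}^m$ and $\mathcal{D}:\mathbb{R}^m\to X$ are any encoder/decoder pair with a linear decoder $\mathcal{D}$, then $$\int_X\|\mathcal{D}\circ\mathcal{E}(u)-u\|_{L^2}^2\,d\mu(u)\ge\sum_{k>m}\lambda_k ,$$ where $\lambda_k$ is the $k$-th eigenvalue of the covariance operator $\Gamma_\mu$ of $\mu$. In particular, the encoding error satisfies $\widehat{\mathscr{E}}_{\mathcal{E}}\ge\sqrt{\sum_{k>m}\lambda_k}$.
   Context: $D\subset\mathbb{R}^d$ is a compact domain. Here an encoder is any Borel measurable (not necessarily linear) map $\mathcal{E}:X\to\mathbb{R}^m$. The covariance operator of the mean-zero measure $\mu$ is $\Gamma_\mu=\int_X u\otimes u\,d\mu(u)$, with eigenvalues $\lambda_1\ge\lambda_2\ge\dots$ repeated according to multiplicity. The encoding error is $\widehat{\mathscr{E}}_{\mathcal{E}}=\left(\int_X\|\mathcal{D}\circ\mathcal{E}(u)-u\|_{L^2}^2\,d\mu(u)\right)^{1/2}$. *)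

(* Defs.v *)
From HB Require Import structures.
From mathcomp Require Import all_boot all_order all_algebra.
From mathcomp Require Import all_classical all_reals all_analysis measurable_realfun.

Set Implicit Arguments.
Unset Strict Implicit.
Unset Printing Implicit Defensive.
Import Order.TTheory GRing.Theory Num.Theory numFieldNormedType.Exports.
Local Open Scope classical_set_scope.
Local Open Scope ring_scope.

Section L2_def.
Context d (T : measurableType d) (R : realType).
Variable nu : {measure set T -> \bar R}.

(* [LspaceType2 nu] is the library's quotient of the square-integrable
   functions by a.e. equality, but without its normed space structure.  [L2]
   is an alias carrying it: operations are those of representatives, and
   [`|u|] is the L2-norm of any representative (cf. [L2_normE], [L2_addE],
   [L2_scaleE] and [L2P]). *)
Definition L2 : Type := LspaceType2 nu.

HB.instance Definition _ := gen_eqMixin L2.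
HB.instance Definition _ := gen_choiceMixin L2.

Definition fun_of_L2 (u : L2) : T -> R := aqEqMfun_to_fun (LebesgueSpace.sort u).

Coercion fun_of_L2 : L2 >-> Funclass.

Lemma L2_measurable (u : L2) : measurable_fun [set: T] u.
Proof. exact: (@measurable_funPT _ _ T (measurableTypeR R) (repr (LebesgueSpace.sort u))). Qed.

Lemma L2_finite_norm (u : L2) : finite_norm nu 2%:E u.
Proof. exact: Lebesgue_finite. Qed.

Lemma L2_Lfun (u : L2) : (u : T -> R) \in Lfun nu 2%:E.
Proof.
apply/andP; split; apply/mem_set; [exact: L2_measurable|exact: L2_finite_norm].
Qed.

Lemma L2P (u v : L2) : u = v <-> u = v %[ae nu].
Proof.
split=> [->|uv]; first exact: ae_eq_refl.
case: u v uv => [u [[fu]]] [v [[fv]]] uv.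
have /eqP e : u == v.
  apply/eqP; rewrite -[u]reprK -[v]reprK; apply/eqmodP.
  exact/asboolP.
by case: _ / e fv {uv} => fv; rewrite (Prop_irrelevance fu fv).
Qed.

Lemma ae_eq_Lnorm2 (f g : T -> R) :
  measurable_fun [set: T] f -> measurable_fun [set: T] g ->
  f = g %[ae nu] ->
  Lnorm nu 2%:E (EFin \o f) = Lnorm nu 2%:E (EFin \o g).
Proof.
move=> mf mg fg; rewrite unlock; congr (_ `^ _)%E.
apply: ge0_ae_eq_integral => //.
- apply/measurable_EFinP.
  apply: (@measurableT_comp _ _ _ _ _ _ (fun x : R => x `^ 2)%R) => //.
  exact/measurableT_comp.
- apply/measurable_EFinP.
  apply: (@measurableT_comp _ _ _ _ _ _ (fun x : R => x `^ 2)%R) => //.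
  exact/measurableT_comp.
- by move=> x _; exact: poweR_ge0.
- by move=> x _; exact: poweR_ge0.
- exact: (ae_eq_comp (fun y => `|y%:E| `^ 2)%E fg).
Qed.

Section of_Lfun.
Variables (f : T -> R) (fP : f \in Lfun nu 2%:E).

Let mf : {mfun T >-> measurableTypeR R} :=
  HB.pack f (@isMeasurableFun.Build _ _ T (measurableTypeR R) f
    (set_mem (sub_Lfun_mfun fP))).

Let cls : {mfun_ nu, T >-> measurableTypeR R} := (\pi mf)%qT.

Let clsE : (cls : T -> R) = f %[ae nu].
Proof. by have /eqmodP/asboolP := reprK cls. Qed.

Let cls_fin : finite_norm nu 2%:E cls.
Proof.
rewrite /finite_norm (ae_eq_Lnorm2 _ _ clsE).
- exact: set_mem (sub_Lfun_finLfun fP).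
- exact: (@measurable_funPT _ _ T (measurableTypeR R) (repr cls)).
- exact: set_mem (sub_Lfun_mfun fP).
Qed.

Definition L2_of : L2 := HB.pack_for (LspaceType2 nu) cls
  (isFinLebesgue.Build _ _ _ _ _ (lee1n 2) cls cls_fin).

Lemma L2_ofE : L2_of = f %[ae nu].
Proof. exact: clsE. Qed.

End of_Lfun.

Let p1 : (1 <= 2%:E :> \bar R)%E := lee1n 2.

Let lf (u : L2) : LfunType nu p1 := Lfun_Sub p1 (L2_Lfun u).

Let of_lf (f : LfunType nu p1) : L2 := L2_of (LfunP f).

Definition L2_zero : L2 := of_lf 0.
Definition L2_add (u v : L2) : L2 := of_lf (lf u + lf v).
Definition L2_opp (u : L2) : L2 := of_lf (- lf u).
Definition L2_scale (a : R) (u : L2) : L2 := of_lf (a *: lf u).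
Definition L2_norm (u : L2) : R := fine (Lnorm nu 2%:E (EFin \o u)).

Let ofE f fP : \forall x \ae nu, @L2_of f fP x = f x.
Proof. by apply: filterS (L2_ofE fP) => x; exact. Qed.

Let eqL2 (u v : L2) : (\forall x \ae nu, u x = v x) -> u = v.
Proof. by move=> uv; apply/L2P; apply: filterS uv. Qed.

Let addE u v : \forall x \ae nu, L2_add u v x = u x + v x.
Proof. exact: ofE. Qed.

Let scaleE a u : \forall x \ae nu, L2_scale a u x = a * u x.
Proof. exact: ofE. Qed.

Let addA : associative L2_add.
Proof.
move=> u v w; apply: eqL2.
have H1 := addE u (L2_add v w); have H2 := addE v w.
have H3 := addE (L2_add u v) w; have H4 := addE u v.
near=> x.
rewrite (near H1 x)// (near H2 x)// (near H3 x)// (near H4 x)//.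
by rewrite addrA.
Unshelve. all: by end_near. Qed.

Let addC : commutative L2_add.
Proof. by move=> u v; rewrite /L2_add addrC. Qed.

Let add0 : left_id L2_zero L2_add.
Proof.
move=> u; apply: eqL2.
have H1 := addE L2_zero u; have H2 := ofE (LfunP (0 : LfunType nu p1)).
near=> x.
by rewrite (near H1 x)// (near H2 x)//= add0r.
Unshelve. all: by end_near. Qed.

Let addN : left_inverse L2_zero L2_opp L2_add.
Proof.
move=> u; apply: eqL2.
have H1 := addE (L2_opp u) u; have H2 := ofE (LfunP (0 : LfunType nu p1)).
have H3 := ofE (LfunP (- lf u : LfunType nu p1)).
near=> x.
by rewrite (near H1 x)// (near H2 x)//= (near H3 x)//= addNr.
Unshelve. all: by end_near. Qed.

HB.instance Definition _ := GRing.isZmodule.Build L2 addA addC add0 addN.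

Lemma L2_addE (u v : L2) : \forall x \ae nu, (u + v) x = u x + v x.
Proof. exact: addE. Qed.

Lemma L2_oppE (u : L2) : \forall x \ae nu, (- u) x = - u x.
Proof. exact: ofE. Qed.

Lemma L2_zeroE : \forall x \ae nu, (0 : L2) x = 0.
Proof. exact: ofE. Qed.

Let scaleA a b u : L2_scale a (L2_scale b u) = L2_scale (a * b) u.
Proof.
apply: eqL2.
have H1 := scaleE a (L2_scale b u); have H2 := scaleE b u.
have H3 := scaleE (a * b) u.
near=> x.
by rewrite (near H1 x)// (near H2 x)// (near H3 x)// mulrA.
Unshelve. all: by end_near. Qed.

Let scale1 : left_id 1 L2_scale.
Proof.
move=> u; apply: eqL2; have H1 := scaleE 1 u.
by near=> x; rewrite (near H1 x)// mul1r.
Unshelve. all: by end_near. Qed.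

Let scaleDr : right_distributive L2_scale L2_add.
Proof.
move=> a u v; apply: eqL2.
have H1 := scaleE a (L2_add u v); have H2 := addE u v.
have H3 := addE (L2_scale a u) (L2_scale a v).
have H4 := scaleE a u; have H5 := scaleE a v.
near=> x.
rewrite (near H1 x)// (near H2 x)// (near H3 x)// (near H4 x)// (near H5 x)//.
by rewrite mulrDr.
Unshelve. all: by end_near. Qed.

Let scaleDl u a b : L2_scale (a + b) u = L2_add (L2_scale a u) (L2_scale b u).
Proof.
apply: eqL2.
have H1 := scaleE (a + b) u.
have H3 := addE (L2_scale a u) (L2_scale b u).
have H4 := scaleE a u; have H5 := scaleE b u.
near=> x.
rewrite (near H1 x)// (near H3 x)// (near H4 x)// (near H5 x)//.
by rewrite mulrDl.
Unshelve. all: by end_near. Qed.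

HB.instance Definition _ :=
  GRing.Zmodule_isLmodule.Build R L2 scaleA scale1 scaleDr scaleDl.

Lemma L2_scaleE (a : R) (u : L2) : \forall x \ae nu, (a *: u) x = a * u x.
Proof. exact: scaleE. Qed.

Let norm_of_lf (f : LfunType nu p1) :
  Lnorm nu 2%:E (EFin \o of_lf f) = Lnorm nu 2%:E (EFin \o f).
Proof.
apply: ae_eq_Lnorm2; last exact: L2_ofE.
  exact: L2_measurable.
exact: measurable_funPT.
Qed.

Let normD (u v : L2) : L2_norm (u + v) <= L2_norm u + L2_norm v.
Proof.
rewrite /L2_norm -[u + v]/(of_lf _) norm_of_lf.
exact: (ler_LnormD (lf u) (lf v)).
Qed.

Let normZ (a : R) (u : L2) : L2_norm (a *: u) = `|a| * L2_norm u.
Proof.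
rewrite /L2_norm -[a *: u]/(of_lf _) norm_of_lf.
by have := LnormZ (lf u) a; rewrite /= => ->; rewrite fineM// fin_numElt
   (lt_le_trans _ (Lnorm_ge0 _ _ _))//= ; exact: L2_finite_norm.
Qed.

Let norm_eq0 (u : L2) : L2_norm u = 0 -> u = 0.
Proof.
move=> /(fine_Lnormr_eq0 (f := lf u)) H1; apply: eqL2.
have H2 := L2_zeroE.
by near=> x; rewrite (near H2 x)//; apply: (near H1 x).
Unshelve. all: by end_near. Qed.

HB.instance Definition _ := @Lmodule_isNormed.Build R L2 L2_norm normD normZ norm_eq0.

Lemma L2_normE (u : L2) :
  `|u| = fine (Lnorm nu 2%:E (EFin \o (u : T -> R))).
Proof. by []. Qed.

Definition L2_dot (u v : L2) : R := \int[nu]_x (u x * v x).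

End L2_def.

(* Borel sigma-algebras, generated by the open sets. *)
HB.instance Definition _ (R : realType) (m n : nat) :=
  @isMeasurable.Build (sigma_display (@open 'M[R]_(m, n))) 'M[R]_(m, n)
    <<s @open 'M[R]_(m, n) >> (@sigma_algebra0 _ setT _) (@sigma_algebraC _ _)
    (@sigma_algebra_bigcup _ setT _).

HB.instance Definition _ d (T : measurableType d) (R : realType)
    (nu : {measure set T -> \bar R}) :=
  @isMeasurable.Build (sigma_display (@open (L2 nu))) (L2 nu)
    <<s @open (L2 nu) >> (@sigma_algebra0 _ setT _) (@sigma_algebraC _ _)
    (@sigma_algebra_bigcup _ setT _).

Section borel_rV.
Variable R : realType.

Lemma open_measurable_rV n (U : set 'rV[R]_n) : open U -> measurable U.
Proof. exact: sub_sigma_algebra. Qed.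

Lemma closed_measurable_rV n (F : set 'rV[R]_n) : closed F -> measurable F.
Proof.
move=> cF; rewrite -[F]setCK; apply: measurableC.
by apply: open_measurable_rV; exact: closed_openC.
Qed.

Lemma compact_measurable_rV n (D : set 'rV[R]_n) : compact D -> measurable D.
Proof.
move=> cD; apply: closed_measurable_rV; apply: compact_closed cD.
have H : hausdorff_space 'rV[R]_n by exact: norm_hausdorff.
exact: H.
Qed.

Lemma measurable_coord n (i : 'I_n) :
  measurable_fun [set: 'rV[R]_n] (fun v => v 0 i : measurableTypeR R).
Proof.
move=> _ Y mY; rewrite setTI.
have : measurable_fun [set: 'rV[R]_n] (fun v => v 0 i : R).
  apply: (measurability _ (RGenOpens.measurableE R)) => _ [_ [a [b ->]] <-].
  rewrite setTI; apply: open_measurable_rV.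
  apply: open_comp; last exact: interval_open.
  by move=> v _; exact: coord_continuous.
by move=> /(_ measurableT Y mY); rewrite setTI.
Qed.

Lemma open_rV_bigcup n (U : set 'rV[R]_n) : open U ->
  U = \bigcup_(q in [set q : 'rV[rat]_n * nat |
      [set v : 'rV[R]_n | forall i, `|ratr (q.1 0 i) - v 0 i| < q.2.+1%:R^-1] `<=` U])
    [set v : 'rV[R]_n | forall i, `|ratr (q.1 0 i) - v 0 i| < q.2.+1%:R^-1].
Proof.
move=> oU; apply/seteqP; split => [v Uv|v [q]]; last exact.
have /nbhs_ballP[e /= e0 eU] : nbhs v U by exact: open_nbhs_nbhs.
pose k := Num.truncn (2 / e).
have k0 : 0 < k.+1%:R^-1 :> R by rewrite invr_gt0.
have ke : k.+1%:R^-1 + k.+1%:R^-1 < e.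
  have : 2 / e < k.+1%:R by exact: Num.Theory.truncnS_gt.
  rewrite ltr_pdivrMr// => h.
  by rewrite -mulr2n -[X in X *+ _]div1r -mulrnAl ltr_pdivrMr// mulrC.
have H i : {q : rat | `|ratr q - v 0 i| < k.+1%:R^-1}.
  apply/cid.
  have : v 0 i - k.+1%:R^-1 < v 0 i + k.+1%:R^-1.
    by rewrite ltrBlDr -addrA ltrDl addr_gt0.
  move=> /rat_in_itvoo[q]; rewrite in_itv/= => /andP[h1 h2]; exists q.
  by rewrite ltr_distl h1 h2.
exists (\row_i sval (H i), k) => /=.
  move=> w /= wq; apply: eU; split => // i j; rewrite ord1.
  have := wq j; rewrite mxE; case: (H j) => q /= vq qw.
  rewrite /ball/=.
  rewrite (le_lt_trans _ ke)// -[v 0 j - w 0 j](subrKA (ratr q)).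
  by rewrite (le_trans (ler_normD _ _))// lerD ?ltW// distrC.
by move=> i; rewrite mxE; case: (H i).
Qed.

Lemma measurable_fun_rV d (T : measurableType d) n (f : T -> 'rV[R]_n) :
  (forall i, measurable_fun [set: T] (fun x => f x 0 i : measurableTypeR R)) ->
  measurable_fun [set: T] f.
Proof.
move=> mf; apply: (@measurability _ _ _ _ _ _ (@open 'rV[R]_n)) => //.
move=> _ [U oU <-]; rewrite setTI (open_rV_bigcup oU) preimage_bigcup.
rewrite bigcup_mkcond; apply: countable_bigcupT_measurable.
  exact: countableP.
move=> q; case: ifPn => // _.
rewrite (_ : _ @^-1` _ = \big[setI/setT]_(i < n)
   ((fun x => f x 0 i) @^-1` ball (ratr (q.1 0 i) : R) q.2.+1%:R^-1)).
  apply: bigsetI_measurable => i _; rewrite -[X in measurable X]setTI.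
  by apply: (mf i) => //; exact: measurable_ball.
rewrite -bigcap_seq; apply/seteqP; split => x /= h i; first by move=> _; exact: h.
by apply: h; rewrite /= mem_index_enum.
Qed.

End borel_rV.

Section lebesgue_rV.
Variable R : realType.

Definition rV_cons n (p : measurableTypeR R * 'rV[R]_n) : 'rV[R]_n.+1 :=
  \row_i oapp (p.2 0) p.1 (unlift ord0 i).

Definition rV_uncons n (v : 'rV[R]_n.+1) : measurableTypeR R * 'rV[R]_n :=
  (v 0 ord0, \row_i v 0 (lift ord0 i)).

Lemma rV_consK n : cancel (@rV_cons n) (@rV_uncons n).
Proof.
move=> [x v]; rewrite /rV_uncons /rV_cons !mxE unlift_none/=; congr pair.
by apply/rowP => i; rewrite !mxE liftK.
Qed.

Lemma rV_unconsK n : cancel (@rV_uncons n) (@rV_cons n).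
Proof.
move=> v; apply/rowP => i; rewrite !mxE.
by case: unliftP => [j|] -> //=; rewrite mxE.
Qed.

Lemma measurable_rV_cons n : measurable_fun [set: _] (@rV_cons n).
Proof.
apply: measurable_fun_rV => i.
rewrite (_ : (fun x => _) = oapp (fun j (p : measurableTypeR R * 'rV[R]_n) =>
    p.2 0 j : measurableTypeR R) fst (unlift ord0 i)).
  case: unliftP => [j|] _ /=; last exact: measurable_fst.
  exact: (measurableT_comp (@measurable_coord R n j)).
by apply/funext => p; rewrite mxE; case: unlift.
Qed.

Lemma measurable_rV_uncons n : measurable_fun [set: _] (@rV_uncons n).
Proof.
apply: measurable_fun_pair; first exact: measurable_coord.
apply: measurable_fun_rV => i.
rewrite (_ : (fun x => _) = (fun v : 'rV[R]_n.+1 => v 0 (lift ord0 i))).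
  exact: measurable_coord.
by apply/funext => v; rewrite mxE.
Qed.

Section step.
Variables (n : nat) (m : {sigma_finite_measure set 'rV[R]_n -> \bar R}).

Let step := pushforward (@lebesgue_measure R \x m)%E (@rV_cons n).

Let mcons := @measurable_rV_cons n.

Let step0 : step set0 = 0%E. Proof. exact: measure0. Qed.

Let step_ge0 A : (0 <= step A)%E. Proof. exact: measure_ge0. Qed.

Let step_sigma_additive : semi_sigma_additive step.
Proof. exact: measure_semi_sigma_additive. Qed.

HB.instance Definition _ := isMeasure.Build _ _ _ step
  step0 step_ge0 step_sigma_additive.

Let step_sigma_finite : sigma_finite [set: 'rV[R]_n.+1] step.
Proof.
have /sigma_finiteP[F [FT ndF Foo]] := sigma_finiteT (@lebesgue_measure R).
have /sigma_finiteP[G [GT ndG Goo]] := sigma_finiteT m.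
exists (fun k => @rV_uncons n @^-1` (F k `*` G k)).
  apply/esym/seteqP; split=> // v _.
  have [k _ Fk] : (\bigcup_k F k) (rV_uncons v).1 by rewrite -FT.
  have [l _ Gl] : (\bigcup_k G k) (rV_uncons v).2 by rewrite -GT.
  exists (maxn k l) => //; split.
    by apply: (subsetPset _ _ (ndF _ _ (leq_maxl k l))).
  by apply: (subsetPset _ _ (ndG _ _ (leq_maxr k l))).
move=> k; have [mF Fk] := Foo k; have [mG Gk] := Goo k; split.
  rewrite -[X in measurable X]setTI; apply: measurable_rV_uncons => //.
  exact: measurableX.
rewrite /step /pushforward -comp_preimage (_ : _ \o _ = id); last first.
  by apply/funext; exact: rV_consK.
by rewrite preimage_id product_measure1E// lte_mul_pinfty// ge0_fin_numE.
Qed.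

HB.instance Definition _ :=
  Measure_isSigmaFinite.Build _ _ _ step step_sigma_finite.

Definition lebesgue_rVS : {sigma_finite_measure set 'rV[R]_n.+1 -> \bar R} :=
  step.

End step.

(* Iterated product of the one-dimensional Lebesgue measure, transported along
   R * R^n -> R^(n+1); [lebesgue_rV_box] gives the volume of boxes. *)
Fixpoint lebesgue_rV (n : nat) : {sigma_finite_measure set 'rV[R]_n -> \bar R} :=
  if n is n'.+1 return {sigma_finite_measure set 'rV[R]_n -> \bar R}
  then lebesgue_rVS (lebesgue_rV n') else dirac (0 : 'rV[R]_0).

Lemma lebesgue_rV_box n (a b : 'I_n -> R) : (forall i, a i <= b i) ->
  lebesgue_rV n [set v : 'rV[R]_n | forall i, a i <= v 0 i <= b i] =
  (\prod_(i < n) (b i - a i))%:E.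
Proof.
elim: n a b => [|n ih] a b ab.
  by rewrite big_ord0 /= /dirac/= indicE mem_set//= => -[].
rewrite big_ord_recl EFinM -ih//= /lebesgue_rVS/= /pushforward.
set B := [set v : 'rV[R]_n | _].
rewrite (_ : _ @^-1` _ = `[a ord0, b ord0]%classic `*` B).
  rewrite product_measure1E//.
    congr (_ * _)%E; rewrite [LHS](@lebesgue_measure_itv R `[a ord0, b ord0])/= lte_fin -EFinB.
    by case: ltgtP (ab ord0) => // ->; rewrite subrr.
  rewrite (_ : B = \big[setI/setT]_(i < n) ((fun v : 'rV[R]_n => v 0 i : measurableTypeR R) @^-1`
      `[a (lift ord0 i), b (lift ord0 i)]%classic)).
    apply: bigsetI_measurable => i _; rewrite -[X in measurable X]setTI.
    by apply: measurable_coord => //; exact: measurable_itv.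
  rewrite -bigcap_seq; apply/seteqP; split => v /= h i.
    by move=> _; rewrite /= in_itv/=; exact: h.
  by have := h i; rewrite /= in_itv/=; apply; exact: mem_index_enum.
apply/seteqP; split => [[x v]|[x v] []] /=.
  move=> h; split; first by have := h ord0; rewrite mxE unlift_none in_itv.
  by move=> i /=; have := h (lift ord0 i); rewrite mxE liftK.
rewrite in_itv/= => hx hv i; rewrite mxE.
by case: unliftP => [j|] -> //=; exact: hv.
Qed.

End lebesgue_rV.

Definition lebesgue_on (R : realType) (d : nat) (D : set 'rV[R]_d)
    (cD : compact D) : {measure set 'rV[R]_d -> \bar R} :=
  mrestr (lebesgue_rV R d) (compact_measurable_rV cD).

Section bochner.
Context d (T : measurableType d) (R : realType) (P : probability T R)
  (V : normedModType R).

Definition simple_fun (s : {fimfun T >-> V}) : Prop :=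
  forall y, measurable (s @^-1` [set y]).

Definition simple_integral (s : {fimfun T >-> V}) : V :=
  \sum_(y \in [set: V]) fine (P (s @^-1` [set y])) *: y.

(* [f] is Bochner integrable, with integral [I]. *)
Definition is_bochner_integral (f : T -> V) (I : V) : Prop :=
  exists s : nat -> {fimfun T >-> V},
    [/\ forall n, simple_fun (s n),
        {ae P, forall x, s n x @[n --> \oo] --> f x},
        (\int[P]_x (`|f x - s n x|)%:E)%E @[n --> \oo] --> 0%E
      & simple_integral (s n) @[n --> \oo] --> I].

(* Junk value 0 if [f] is not Bochner integrable. *)
Definition bochner_integral (f : T -> V) : V :=
  xget 0 [set I | is_bochner_integral f I].

End bochner.

(* The operator [\int u (x) u dmu], with [(u (x) u) v = <u, v> u]. *)
Definition covariance_op d (T : measurableType d) (R : realType)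
    (nu : {measure set T -> \bar R}) (mu : probability (L2 nu) R)
    (v : L2 nu) : L2 nu :=
  bochner_integral mu (fun u => L2_dot u v *: u).

Section eigenvalues.
Context (R : realType) (V : lmodType R).

Definition has_dim (S : set V) (n : nat) : Prop :=
  exists e : 'I_n -> V,
    (forall c : 'I_n -> R, \sum_i c i *: e i = 0 -> forall i, c i = 0) /\
    S = [set v | exists c : 'I_n -> R, v = \sum_i c i *: e i].

(* [lam 0 >= lam 1 >= ...] are the eigenvalues, repeated according to
   multiplicity, of a compact positive semidefinite operator [G]: each nonzero
   [a] is listed as many times as the dimension of [ker (G - a)] (possibly
   zero).  If [G] has finite rank, the sequence is completed by zeros; if it
   has infinitely many positive eigenvalues, 0 is never reached. *)
Definition eigenvalue_sequence (G : V -> V) (lam : nat -> R) : Prop :=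
  [/\ nonincreasing_seq lam,
      forall k, 0 <= lam k
    & forall a, a != 0 -> exists2 n,
        ([set k | lam k = a] #= `I_n)%card & has_dim [set v | G v = a *: v] n].

End eigenvalues.

Definition encoding_error d (T : measurableType d) (R : realType)
    (nu : {measure set T -> \bar R}) (mu : probability (L2 nu) R) (m : nat)
    (Enc : L2 nu -> 'rV[R]_m) (Dec : 'rV[R]_m -> L2 nu) : \bar R :=
  sqrte (\int[mu]_u (`|Dec (Enc u) - u| ^+ 2)%:E)%E.

(* Main.v *)
(* Let e_0, ..., e_(N-1) be orthonormal eigenvectors of the covariance operator
   for lam_0 >= ... >= lam_(N-1) > 0.  As the range of the decoder has dimension
   at most m, there are N - m orthonormal vectors z_j in the span of the e_k
   that are orthogonal to it, so Bessel's inequality gives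
     |Dec (Enc u) - u|^2 >= \sum_j <Dec (Enc u) - u, z_j>^2 = \sum_j <u, z_j>^2.
   Integrating, the right-hand side becomes \sum_k lam_k b_k with
   b_k = \sum_j <e_k, z_j>^2.  By Bessel again b_k is in [0, 1], and the b_k sum
   to N - m; since lam is nonincreasing, such a weighted sum is least when the
   weights sit on the N - m last indices. *)

Require Import Defs.
From HB Require Import structures.
From mathcomp Require Import all_boot all_order all_algebra.
From mathcomp Require Import all_classical all_reals all_analysis measurable_realfun.

Set Implicit Arguments.
Unset Strict Implicit.
Unset Printing Implicit Defensive.
Import Order.TTheory GRing.Theory Num.Theory numFieldNormedType.Exports.
Local Open Scope classical_set_scope.
Local Open Scope ring_scope.

(** * Weighted sums of a nonincreasing sequence *)

(** The weights [b k] and the indicators of [m <= k] have the same sum, so [lam k] may be replaced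
    by [lam k - lam m] in the difference of the two sides. Each term is then a product of two
    factors of the same sign, whether [k < m] or [m <= k]. *)
Lemma ge_sum_weights (R : realDomainType) (lam b : nat -> R) (m N : nat) :
  (forall k l, (k <= l)%N -> lam l <= lam k) ->
  (forall k, (k < N)%N -> 0 <= b k <= 1) ->
  (m <= N)%N -> \sum_(k < N) b k = (N - m)%:R ->
  \sum_(m <= k < N) lam k <= \sum_(k < N) lam k * b k.
Proof.
move=> dlam b01 mN sb.
have -> : \sum_(m <= k < N) lam k = \sum_(k < N) lam k * (m <= k)%:R.
  rewrite [LHS](big_nat_widenl _ 0)// big_mkord big_mkcond/=.
  by apply: eq_bigr => k _; case: leqP; rewrite (mulr1, mulr0).
rewrite -subr_ge0 -sumrB.
have s0 : \sum_(k < N) lam m * (b k - (m <= k)%:R) = 0.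
  rewrite -mulr_sumr sumrB sb.
  suff -> : \sum_(k < N) (m <= k)%:R = (N - m)%:R :> R by rewrite subrr mulr0.
  rewrite -(big_mkord xpredT (fun k => (m <= k)%:R)) (big_cat_nat (leq0n m) mN)//=.
  rewrite big1_seq; last first.
    by move=> k; rewrite mem_index_iota/= => /ltn_geF ->.
  rewrite add0r (eq_big_nat _ _ (F2 := fun=> 1)); last by move=> k /andP[->].
  by rewrite sumr_const_nat.
rewrite -[leLHS]s0 ler_sum// => k _; rewrite -mulrBr -subr_ge0 -mulrBl.
have /andP[b0 b1] := b01 k (ltn_ord k).
case: leqP => [mk|/ltnW km]; last first.
  by rewrite subr0 mulr_ge0// subr_ge0 dlam.
by rewrite mulr_le0// subr_le0// dlam.
Qed.

(** * Symmetric bilinear forms *)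

Section symmetric_bilinear.
Context (R : realType) (V : lmodType R).

(** A predicate on bare functions, so that one set of lemmas serves both the inner product and the
    covariance form. *)
Record symmetric_bilinear (B : V -> V -> R) : Prop := SymmetricBilinear {
  bilinC : forall u v, B u v = B v u;
  bilinDl : forall u v w, B (u + v) w = B u w + B v w;
  bilinZl : forall a u w, B (a *: u) w = a * B u w }.

Variables (B : V -> V -> R) (Bsb : symmetric_bilinear B).

Lemma bilin0l w : B 0 w = 0.
Proof. by rewrite -(scale0r 0) (bilinZl Bsb) mul0r. Qed.

Lemma bilinBl u v w : B (u - v) w = B u w - B v w.
Proof. by rewrite -(scaleN1r v) (bilinDl Bsb) (bilinZl Bsb) mulN1r. Qed.

Lemma bilin_suml (I : Type) (r : seq I) (c : I -> R) (v : I -> V) w :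
  B (\sum_(i <- r) c i *: v i) w = \sum_(i <- r) c i * B (v i) w.
Proof.
have H : {morph B^~ w : x y / x + y} by move=> x y; exact: bilinDl.
rewrite (big_morph _ H (bilin0l w)).
by apply: eq_bigr => i _; exact: bilinZl.
Qed.

Lemma bilin_sumr (I : Type) (r : seq I) (c : I -> R) (v : I -> V) w :
  B w (\sum_(i <- r) c i *: v i) = \sum_(i <- r) c i * B w (v i).
Proof.
rewrite bilinC// bilin_suml; apply: eq_bigr => i _.
by rewrite (bilinC Bsb).
Qed.

End symmetric_bilinear.

(** * Orthonormal families in an abstract inner product space *)

Section inner_product.
Context (R : realType) (V : lmodType R).
Variables (dot : V -> V -> R) (dotP : symmetric_bilinear dot).
Hypotheses (dot_ge0 : forall u, 0 <= dot u u)
  (dot_eq0 : forall u, dot u u = 0 -> u = 0).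

(** Families are indexed by [nat] and only the first [n] values count, so that [append] can lengthen
    them without casts between ordinal types. *)
Definition orthonormal n (e : nat -> V) :=
  forall i j, (i < n)%N -> (j < n)%N -> dot (e i) (e j) = (i == j)%:R.

Lemma orthonormal_sum n e (c : 'I_n -> R) (k : 'I_n) : orthonormal n e ->
  dot (\sum_i c i *: e i) (e k) = c k.
Proof.
move=> oe; rewrite (bilin_suml dotP) (bigD1 k)//= oe// eqxx mulr1 big1 ?addr0//.
by move=> i ik; rewrite oe//= -val_eqE/= in ik *; rewrite (negbTE ik) mulr0.
Qed.

(** The projection [p] of [u] onto the span satisfies [dot p p = dot p u], so
    [dot (u - p) (u - p) >= 0] is the claim. *)
Lemma bessel n e u : orthonormal n e -> \sum_(i < n) dot u (e i) ^+ 2 <= dot u u.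
Proof.
move=> oe; pose p := \sum_(i < n) dot u (e i) *: e i.
have pu : dot p u = \sum_(i < n) dot u (e i) ^+ 2.
  rewrite (bilin_suml dotP); apply: eq_bigr => i _.
  by rewrite (bilinC dotP (e i)).
have pp : dot p p = dot p u.
  rewrite pu [LHS](bilin_sumr dotP); apply: eq_bigr => i _.
  by rewrite orthonormal_sum.
have := dot_ge0 (u - p).
rewrite (bilinBl dotP) 2!(bilinC dotP _ (_ - _)) !(bilinBl dotP) pp (bilinC dotP u p) pu.
by rewrite subrr subr0 subr_ge0.
Qed.

(** Orthogonality to the [f j] is a system of [p] linear equations in [n > p] coefficients, so it
    has a nonzero solution: a row of the kernel of [A]. Freeness of [b] makes the resulting
    combination nonzero, hence normalizable. *)
Lemma exists_unit_orthogonal n p (b : 'I_n -> V) (f : 'I_p -> V) :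
  (forall c : 'I_n -> R, \sum_i c i *: b i = 0 -> forall i, c i = 0) ->
  (p < n)%N ->
  exists c : 'I_n -> R, let v := \sum_i c i *: b i in
    dot v v = 1 /\ forall j, dot v (f j) = 0.
Proof.
move=> free_b pn; pose A := \matrix_(i < n, j < p) dot (b i) (f j).
have : kermx A != 0.
  rewrite kermx_eq0 /row_free; apply: contraTN pn => /eqP <-.
  by rewrite -leqNgt rank_leq_col.
rewrite -nz_row_eq0; set x := nz_row _ => x0.
have xA : x *m A = 0 by apply/sub_kermxP; exact: nz_row_sub.
pose v0 := \sum_i x 0 i *: b i.
have v00 : dot v0 v0 != 0.
  apply: contraNN x0 => /eqP /dot_eq0 /free_b xi0.
  by apply/eqP/rowP => i; rewrite xi0 mxE.
have v0f j : dot v0 (f j) = 0.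
  rewrite (bilin_suml dotP); transitivity ((x *m A) 0 j); last by rewrite xA mxE.
  by rewrite mxE; apply: eq_bigr => i _; rewrite !mxE.
pose t := (Num.sqrt (dot v0 v0))^-1.
exists (fun i => t * x 0 i) => /=.
have -> : \sum_i (t * x 0 i) *: b i = t *: v0.
  by rewrite scaler_sumr; apply: eq_bigr => i _; rewrite scalerA.
split=> [|j]; last by rewrite (bilinZl dotP) v0f mulr0.
rewrite (bilinZl dotP) (bilinC dotP) (bilinZl dotP) mulrA -invfM -expr2.
by rewrite sqr_sqrtr// mulVf.
Qed.

Lemma orthonormal_free n e (c : 'I_n -> R) : orthonormal n e ->
  \sum_i c i *: e i = 0 -> forall i, c i = 0.
Proof.
by move=> oe c0 i; rewrite -(orthonormal_sum c i oe) c0 (bilin0l dotP).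
Qed.

Definition append (n : nat) (e : nat -> V) (v : V) (i : nat) :=
  if (i < n)%N then e i else v.

Lemma append_lt n e v i : (i < n)%N -> append n e v i = e i.
Proof. by rewrite /append => ->. Qed.

Lemma append_last n e v : append n e v n = v.
Proof. by rewrite /append ltnn. Qed.

Lemma orthonormal_append n e v : orthonormal n e -> dot v v = 1 ->
  (forall i, (i < n)%N -> dot v (e i) = 0) -> orthonormal n.+1 (append n e v).
Proof.
move=> oe vv ve i j.
rewrite ltnS leq_eqVlt => /predU1P[->|ni]; rewrite ltnS leq_eqVlt => /predU1P[->|nj].
- by rewrite append_last vv eqxx.
- by rewrite append_last append_lt// ve// gtn_eqF.
- by rewrite append_last append_lt// (bilinC dotP) ve// ltn_eqF.
- by rewrite !append_lt// oe.
Qed.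

(** Induction on [p]: the next vector has to be orthogonal to the [p] vectors already found and to
    the [m] vectors [f i]. These are [p + m < N] conditions on [N] coefficients. *)
Lemma orthonormal_avoiding N m p (e : nat -> V) (f : 'I_m -> V) :
  orthonormal N e -> (p + m <= N)%N ->
  exists z : nat -> V, [/\ orthonormal p z,
    forall j, (j < p)%N -> exists c : 'I_N -> R, z j = \sum_k c k *: e k
    & forall j i, (j < p)%N -> dot (z j) (f i) = 0].
Proof.
move=> oe; elim: p => [_|p ih pN]; first by exists e; split.
have [z [oz ze zf]] := ih (ltnW pN).
pose g (i : 'I_(p + m)) :=
  match fintype.split i with inl j => z j | inr j => f j end.
have [c] := exists_unit_orthogonal g (fun c => @orthonormal_free N e c oe) pN.
set v := \sum_i _ => /= -[vv vg].
have vz j : (j < p)%N -> dot v (z j) = 0.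
  move=> jp; have := vg (unsplit (inl (Ordinal jp))).
  by rewrite /g unsplitK.
have vf j : dot v (f j) = 0.
  by have := vg (unsplit (inr j)); rewrite /g unsplitK.
exists (append p z v); split.
- exact: orthonormal_append.
- move=> j; rewrite ltnS leq_eqVlt => /predU1P[->|jp].
    by exists c; rewrite append_last.
  by rewrite append_lt//; exact: ze.
- move=> j i; rewrite ltnS leq_eqVlt => /predU1P[->|jp].
    by rewrite append_last.
  by rewrite append_lt// zf.
Qed.

(** * Eigenvectors and the quadratic form of an operator *)

Section eigenvectors.
Variables (C : V -> V -> R) (CP : symmetric_bilinear C).
Variables (lam : nat -> R).

Lemma ge_sum_quadratic_form N m (e z : nat -> V) :
  (forall k l, (k <= l)%N -> lam l <= lam k) ->
  orthonormal N e -> (m <= N)%N ->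
  (forall k w, (k < N)%N -> C (e k) w = lam k * dot (e k) w) ->
  orthonormal (N - m) z ->
  (forall j, (j < N - m)%N -> exists c : 'I_N -> R, z j = \sum_k c k *: e k) ->
  \sum_(m <= k < N) lam k <= \sum_(j < N - m) C (z j) (z j).
Proof.
move=> dlam oe mN Ce oz ze.
have zE j : (j < N - m)%N -> z j = \sum_(k < N) dot (z j) (e k) *: e k.
  move=> /ze[c ->]; apply: eq_bigr => k _; congr (_ *: _).
  by rewrite orthonormal_sum.
pose b k := \sum_(j < N - m) dot (e k) (z j) ^+ 2.
have Cz (j : 'I_(N - m)) : C (z j) (z j) =
    \sum_(k < N) lam k * dot (e k) (z j) ^+ 2.
  rewrite {1}(zE j)// (bilin_suml CP); apply: eq_bigr => k _.
  by rewrite Ce// (bilinC dotP (z j)) mulrCA -expr2.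
under [leRHS]eq_bigr do rewrite Cz.
rewrite exchange_big/=; under [leRHS]eq_bigr do rewrite -mulr_sumr.
apply: (@ge_sum_weights _ _ b) => //.
- move=> k kN; rewrite sumr_ge0/=; last by move=> *; exact: sqr_ge0.
  by rewrite (le_trans (bessel _ oz))// oe// eqxx.
(* Summed over [k] first, the squares give [dot (z j) (z j) = 1], since [z j] lies in the span of
   the [e k]. *)
- rewrite exchange_big/= (eq_bigr (fun=> 1)) ?sumr_const ?card_ord// => j _.
  have <- : dot (z j) (z j) = 1 by rewrite oz// eqxx.
  rewrite {2}(zE j)// (bilin_suml dotP); apply: eq_bigr => k _.
  by rewrite (bilinC dotP (z j)) expr2.
Qed.

(** Induction on [N]. Fewer than [dim ker (G - lam N)] of the earlier indices carry the eigenvalue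
    [lam N], because [N] itself is counted in that multiplicity. So the eigenspace has room for a
    unit vector orthogonal to the earlier ones of the same eigenvalue. *)
Lemma exists_orthonormal_eigenvectors (G : V -> V) N :
  (forall a v w, a != 0 -> G v = a *: v -> C v w = a * dot v w) ->
  (forall a, a != 0 -> exists2 n,
    ([set k | lam k = a] #= `I_n)%card & has_dim [set v | G v = a *: v] n) ->
  (forall k, (k < N)%N -> lam k != 0) ->
  exists2 e : nat -> V, orthonormal N e &
    forall k, (k < N)%N -> G (e k) = lam k *: e k.
Proof.
move=> GC dimG; elim: N => [|N ih] lam0; first by exists (fun=> 0).
have [|e oe Ge] := ih; first by move=> k kN; rewrite lam0// ltnW.
have [n cardn [b [free_b bE]]] := dimG _ (lam0 N (ltnSn N)).
pose S := [set j : 'I_N.+1 | lam j == lam N]%SET.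
have maxS : ord_max \in S by rewrite inE.
have Sn : (#|S :\ ord_max| < n)%N.
  (* The enumeration [h] of all indices of eigenvalue [lam N] embeds [S] into ['I_n], so
     [#|S| <= n]; removing [ord_max] makes this strict. *)
  have /card_set_bijP[h [hn hinj _]] := cardn.
  have hN : (h N < n)%N by exact: hn.
  (* On [S] the default [Ordinal hN] is never taken. *)
  pose h' (j : 'I_N.+1) : 'I_n := insubd (Ordinal hN) (h j).
  have h'E j : j \in S -> h' j = h j :> nat.
    rewrite inE => /eqP jS; rewrite /h' val_insubd.
    by have : (h j < n)%N := hn _ jS => ->.
  have -> : (#|S :\ ord_max| < n)%N = (#|S| <= n)%N.
    by rewrite (cardsD1 ord_max S) maxS.
  rewrite -(@card_in_imset _ _ h' S); last first.
    move=> i j iS jS /(congr1 val)/=; rewrite !h'E// => hij.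
    apply/val_inj/hinj => //; rewrite inE /=.
      by move: iS; rewrite inE => /eqP.
    by move: jS; rewrite inE => /eqP.
  by rewrite (leq_trans (max_card _))// card_ord.
have [c] := exists_unit_orthogonal
  (fun i : 'I_#|S :\ ord_max| => e (enum_val i)) free_b Sn.
set v := \sum_i _ => /= -[vv vf].
have Gv : G v = lam N *: v.
  have : [set v | G v = lam N *: v] v by rewrite bE; exists c.
  by [].
have ve j : (j < N)%N -> dot v (e j) = 0.
  (* If the eigenvalues agree, [v] was chosen orthogonal to [e j]. If not, symmetry of [C] gives
     [(lam N - lam j) * dot v (e j) = 0]. *)
  move=> jN; have [ljN|ljN] := eqVneq (lam j) (lam N).
    have jS : inord j \in S :\ ord_max.
      by rewrite !inE -val_eqE/= inordK ?ltn_eqF//= ?ljN ?eqxx// ltnW.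
    by have := vf (enum_rank_in jS (inord j)); rewrite enum_rankK_in// inordK// ltnW.
  have H1 := GC _ _ (e j) (lam0 N (ltnSn N)) Gv.
  have H2 := GC _ _ v (lam0 j (ltnW jN)) (Ge _ jN).
  move: H2; rewrite (bilinC CP) H1 (bilinC dotP (e j)) => /eqP.
  rewrite -subr_eq0 -mulrBl mulf_eq0 subr_eq0 eq_sym (negbTE ljN)/=.
  by move/eqP.
exists (append N e v); first exact: orthonormal_append.
move=> k; rewrite ltnS leq_eqVlt => /predU1P[->|kN].
  by rewrite append_last.
by rewrite append_lt// Ge.
Qed.

End eigenvectors.
End inner_product.

(* [ge0_le_integral] would ask for the measurability of [g], here of the distance
   of a function to its Bochner approximants. *)
Lemma ge0_le_integralT d (T : measurableType d) (R : realType)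
    (mu : {measure set T -> \bar R}) (f g : T -> \bar R) :
  (forall x, 0 <= f x)%E -> (forall x, f x <= g x)%E ->
  (\int[mu]_x f x <= \int[mu]_x g x)%E.
Proof.
move=> f0 fg; have g0 x : (0 <= g x)%E := le_trans (f0 x) (fg x).
rewrite !ge0_integralTE//; apply: le_ereal_sup => _ [h hf <-]; exists h => //= x.
exact: le_trans (hf x) (fg x).
Qed.

(** * The inner product of L2 *)

Section L2_inner_product.
Context d (T : measurableType d) (R : realType).
Variable nu : {measure set T -> \bar R}.
Implicit Types u v w : L2 nu.

Lemma L2_mul_integrable u v :
  nu.-integrable [set: T] (EFin \o (fun x => u x * v x)).
Proof.
by apply/Lfun1_integrable; apply: Lfun2_mul_Lfun1; exact: L2_Lfun.
Qed.

Lemma ae_eq_Rintegral (f g : T -> R) :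
  nu.-integrable [set: T] (EFin \o f) -> nu.-integrable [set: T] (EFin \o g) ->
  (\forall x \ae nu, f x = g x) -> \int[nu]_x f x = \int[nu]_x g x.
Proof.
move=> /integrableP[mf _] /integrableP[mg _] fg; congr fine.
by apply: ae_eq_integral => //; apply: filterS fg => x /= -> _.
Qed.

Lemma L2_dot_symmetric_bilinear : symmetric_bilinear (@L2_dot d T R nu).
Proof.
split=> [u v|u v w|a u w].
- by apply: eq_Rintegral => x _; rewrite mulrC.
- rewrite /L2_dot -RintegralD//; [|exact: L2_mul_integrable..].
  apply: ae_eq_Rintegral; first exact: L2_mul_integrable.
    apply: (@eq_integrable _ _ _ _ _ _
      ((fun x => (u x * w x)%:E) \+ (fun x => (v x * w x)%:E))%E) => //.
    by apply: integrableD => //; exact: L2_mul_integrable.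
  by apply: filterS (L2_addE u v) => x E; rewrite -mulrDl; congr (_ * _).
- rewrite /L2_dot -RintegralZl//; last exact: L2_mul_integrable.
  apply: ae_eq_Rintegral; first exact: L2_mul_integrable.
    apply: (@eq_integrable _ _ _ _ _ _
      (fun x => (a%:E * (u x * w x)%:E))%E) => //.
    by apply: integrableZl => //; exact: L2_mul_integrable.
  by apply: filterS (L2_scaleE a u) => x E; rewrite mulrA; congr (_ * _).
Qed.

Let dotP := L2_dot_symmetric_bilinear.

Lemma L2_dot_sqr u : L2_dot u u = `|u| ^+ 2.
Proof.
rewrite L2_normE -powR_mulrn ?fine_ge0 ?Lnorm_ge0// -fine_poweR.
rewrite powR_Lnorm//; congr fine; apply: eq_integral => x _ /=.
by rewrite -expr2 -[LHS]/((u x ^+ 2)%:E) -real_normK ?num_real// powR_mulrn.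
Qed.

Lemma L2_dot_ge0 u : 0 <= L2_dot u u.
Proof. by rewrite L2_dot_sqr sqr_ge0. Qed.

Lemma L2_dot_eq0 u : L2_dot u u = 0 -> u = 0.
Proof.
by rewrite L2_dot_sqr => /eqP; rewrite sqrf_eq0 normr_eq0 => /eqP.
Qed.

(** Bessel's inequality for the family whose only vector is [v] divided by its norm. *)
Lemma L2_cauchy_schwarz u v : `|L2_dot u v| <= `|u| * `|v|.
Proof.
have [->|v0] := eqVneq v 0.
  by rewrite (bilinC dotP) (bilin0l dotP) !normr0 mulr0.
have nv : 0 < `|v| by rewrite normr_gt0.
pose e : nat -> L2 nu := fun=> `|v|^-1 *: v.
have oe : orthonormal (@L2_dot _ _ _ nu) 1 e.
  move=> [|//] [|//] _ _; rewrite eqxx L2_dot_sqr normrZ ger0_norm ?invr_ge0//.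
  by rewrite mulVf ?gt_eqF// expr1n.
have := bessel dotP L2_dot_ge0 u oe; rewrite big_ord1 L2_dot_sqr.
have -> : L2_dot u v = `|v| * L2_dot u (e 0).
  by rewrite !(bilinC dotP u) (bilinZl dotP) mulrA mulfV ?gt_eqF// mul1r.
rewrite normrM normr_id mulrC ler_pM2r// => ue.
by rewrite -ler_sqr ?nnegrE// real_normK ?num_real.
Qed.

Lemma L2_dot_continuous v : continuous (fun u : L2 nu => L2_dot u v).
Proof.
move=> u; have F := nbhs_filter u; apply/(@cvgrPdist_le _ _ _ _ F) => e e0.
(* Adding 1 keeps the denominator positive when [v = 0]. *)
have H : 0 < e / (`|v| + 1) by rewrite divr_gt0// ltr_wpDl.
apply/nbhs_ballP; exists (e / (`|v| + 1)) => //= w.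
rewrite -ball_normE/= => /ltW uw.
have -> : L2_dot u v - L2_dot w v = L2_dot (u - w) v.
  by rewrite (bilinBl dotP).
rewrite (le_trans (L2_cauchy_schwarz _ _))//.
rewrite ler_pdivlMr in uw; last by rewrite ltr_wpDl.
by rewrite (le_trans _ uw)// ler_wpM2l// lerDl.
Qed.

Lemma continuous_measurable_L2 (f : L2 nu -> R) :
  continuous f -> measurable_fun [set: L2 nu] f.
Proof.
move=> cf; apply: (measurability _ (RGenOpens.measurableE R)).
move=> _ [_ [a [b ->]] <-]; rewrite setTI; apply: sub_sigma_algebra.
by apply: open_comp; [move=> u _; exact: cf|exact: interval_open].
Qed.

Lemma measurable_L2_dot v :
  measurable_fun [set: L2 nu] (fun u : L2 nu => L2_dot u v).
Proof. by apply: continuous_measurable_L2; exact: L2_dot_continuous. Qed.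

(** * The covariance form *)

Section covariance_form.
Variable mu : probability (L2 nu) R.
Hypothesis moment2 : (\int[mu]_u (`|u| ^+ 2)%:E < +oo)%E.

(** The form of [covariance_op mu] as a scalar integral: it makes sense and is symmetric without any
    Bochner integrability. [covariance_op_eigenvector] links it to the operator. *)
Definition covariance_form v w : R := \int[mu]_u (L2_dot u v * L2_dot u w).

(** By Cauchy-Schwarz the integrand is dominated by a multiple of [|u|^2], which has finite integral
    by [moment2]. *)
Lemma covariance_form_integrable v w :
  mu.-integrable [set: L2 nu] (EFin \o (fun u => L2_dot u v * L2_dot u w)).
Proof.
have mnorm : measurable_fun [set: L2 nu] (fun u : L2 nu => `|u| ^+ 2).
  apply: measurable_funX; apply: continuous_measurable_L2.
  exact: norm_continuous.
apply: (@le_integrable _ _ _ _ _ measurableT _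
    (fun u : L2 nu => ((`|v| * `|w|)%:E * (`|u| ^+ 2)%:E)%E)).
- by apply/measurable_EFinP/measurable_funM; exact: measurable_L2_dot.
- move=> u _; rewrite lee_fin !normrM normr_id !normr_id.
  rewrite (le_trans (ler_pM _ _ (L2_cauchy_schwarz u v) (L2_cauchy_schwarz u w)))//.
  by rewrite mulrACA mulrC.
- apply: integrableZl => //; apply/integrableP; split.
    exact/measurable_EFinP.
  under eq_integral do rewrite gee0_abs ?lee_fin ?sqr_ge0//.
  exact: moment2.
Qed.

Lemma covariance_form_symmetric_bilinear : symmetric_bilinear covariance_form.
Proof.
split=> [u v|u v w|a u w].
- by apply: eq_Rintegral => x _; rewrite mulrC.
- rewrite /covariance_form -RintegralD//; [|exact: covariance_form_integrable..].
  apply: eq_Rintegral => x _.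
  by rewrite (bilinC dotP x) (bilinDl dotP) !(bilinC dotP _ x) mulrDl.
- rewrite /covariance_form -RintegralZl//; last exact: covariance_form_integrable.
  apply: eq_Rintegral => x _.
  by rewrite (bilinC dotP x) (bilinZl dotP) (bilinC dotP _ x) mulrA.
Qed.

End covariance_form.

(** * Bochner integrals tested against a vector *)

Section bochner_dot.
Context d' (T' : measurableType d') (P : probability T' R).

Lemma simple_integral_dot (s : {fimfun T' >-> L2 nu}) w : simple_fun s ->
  P.-integrable [set: T'] (EFin \o (fun x => L2_dot (s x) w)) /\
  (\int[P]_x (L2_dot (s x) w)%:E = (L2_dot (simple_integral P s) w)%:E)%E.
Proof.
move=> ms; have sfin := fimfunP s.
pose r := finmap.enum_fset (fset_set (range s)).
pose h (y : L2 nu) x := ((L2_dot y w)%:E * (\1_(s @^-1` [set y]) x)%:E)%E.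
have sE x : (L2_dot (s x) w)%:E = (\sum_(y <- r) h y x)%E.
  have sr : s x \in r by rewrite /r in_fset_set// inE; exists x.
  rewrite (bigD1_seq (s x))//=; last exact: finmap.fset_uniq.
  rewrite big1 ?adde0; last first.
    move=> y ys; rewrite /h indicE memNset ?mule0//= => /esym/eqP.
    by rewrite (negbTE ys).
  by rewrite /h indicE mem_set// mule1.
have ih y : P.-integrable [set: T'] (h y).
  by apply: integrableZl => //; apply: integrable_indic; exact: ms.
split.
  apply: (@eq_integrable _ _ _ _ _ _ (fun x => \sum_(y <- r) h y x)%E) => //.
    by move=> x _; rewrite /= sE.
  by apply: integrable_sum => // y _; exact: ih.
under eq_integral do rewrite sE.
rewrite integral_sum// /simple_integral.
(* The sum in [simple_integral] runs over the whole space; outside the range of [s] the preimages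
   are empty and the terms vanish. *)
rewrite -(fsbig_widen (range s))//; last first.
  move=> y [_ ny]; apply/eqP; rewrite scaler_eq0; apply/orP; left.
  rewrite (_ : s @^-1` [set y] = set0) ?measure0//.
  by apply/seteqP; split=> // x /= sx; apply: ny; exists x.
rewrite fsbig_finite//= (bilin_suml dotP) -sumEFin; apply: eq_bigr => y _.
rewrite /h integralZl//; last by apply: integrable_indic; exact: ms.
rewrite integral_indic// setIT.
rewrite muleC EFinM; congr (_ * _)%E; rewrite fineK//.
by apply: fin_num_measure; exact: ms.
Qed.

(** Both sides are limits of the simple integrals tested against [w]: the right one by continuity of
    the inner product, the left one because the error is at most [|w|] times the integral of
    [|f - s n|]. *)
Lemma bochner_integral_dot (f : T' -> L2 nu) (I : L2 nu) w :
  is_bochner_integral P f I ->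
  P.-integrable [set: T'] (EFin \o (fun x => L2_dot (f x) w)) ->
  \int[P]_x L2_dot (f x) w = L2_dot I w.
Proof.
move=> [s [ms _ fs sI]] intf.
have [->|w0] := eqVneq w 0.
  rewrite (bilinC dotP) (bilin0l dotP).
  under eq_Rintegral do rewrite (bilinC dotP) (bilin0l dotP).
  by rewrite Rintegral_cst// mul0r.
have nw : 0 < `|w| by rewrite normr_gt0.
have c1 : L2_dot (simple_integral P (s n)) w @[n --> \oo] --> L2_dot I w.
  apply: (@continuous_cvg _ _ _ _ _ _ (fun u => L2_dot u w)) => //.
  exact: L2_dot_continuous.
have bnd n : (`|\int[P]_x L2_dot (f x) w - L2_dot (simple_integral P (s n)) w|%:E <=
    `|w|%:E * \int[P]_x (`|f x - s n x|)%:E)%E.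
  have [ints intsE] := simple_integral_dot w (ms n).
  pose g x := L2_dot (f x) w - L2_dot (s n x) w.
  have intg : P.-integrable [set: T'] (EFin \o g).
    apply: (@eq_integrable _ _ _ _ _ _
      ((EFin \o (fun x => L2_dot (f x) w)) \-
       (EFin \o (fun x => L2_dot (s n x) w)))%E) => //.
    exact: integrableB.
  have -> : \int[P]_x L2_dot (f x) w - L2_dot (simple_integral P (s n)) w =
      \int[P]_x g x.
    by rewrite /g RintegralB//; congr (_ - _); rewrite /Rintegral intsE.
  have mg := measurable_int _ intg.
  rewrite -abse_EFin /Rintegral fineK ?integrable_fin_num//.
  rewrite (le_trans (le_abse_integral _ _ _))//.
  (* The factor [|w|] is moved to the side of [g], which is known to be measurable; nothing of the
     kind is assumed of [|f x - s n x|]. *)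
  rewrite -lee_pdivrMl// -ge0_integralZl_EFin//; last exact: measurableT_comp.
  apply: ge0_le_integralT => x.
    by rewrite mule_ge0// lee_fin invr_ge0.
  rewrite /= -EFinM lee_fin ler_pdivrMl// mulrC.
  have -> : g x = L2_dot (f x - s n x) w.
    by rewrite (bilinBl dotP).
  exact: L2_cauchy_schwarz.
have c2 : L2_dot (simple_integral P (s n)) w @[n --> \oo] -->
    \int[P]_x L2_dot (f x) w.
  have /fine_cvgP[finfs fs0] := fs.
  apply/cvgrPdist_le => e e0.
  have H : 0 < e / `|w| by rewrite divr_gt0.
  have {}fs0 := (cvgrPdist_le _ _).1 fs0 _ H.
  near=> n.
  have fn : (\int[P]_x (`|f x - s n x|)%:E)%E \is a fin_num by near: n.
  rewrite -lee_fin (le_trans (bnd n))// -(fineK fn) -EFinM lee_fin mulrC.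
  rewrite -ler_pdivlMr//.
  have : `|0 - fine (\int[P]_x (`|f x - s n x|)%:E)%E| <= e / `|w|.
    by near: n; exact: fs0.
  by rewrite sub0r normrN; apply: le_trans; exact: ler_norm.
by apply: (cvg_unique _ c2 c1); exact: norm_hausdorff.
Unshelve. all: by end_near. Qed.

End bochner_dot.

(* As [covariance_op mu v = a *: v != 0] for [v != 0], the Bochner integral
   defining it is not the junk value. *)
Lemma covariance_op_eigenvector (mu : probability (L2 nu) R) a v w :
  (\int[mu]_u (`|u| ^+ 2)%:E < +oo)%E ->
  a != 0 -> covariance_op mu v = a *: v ->
  covariance_form mu v w = a * L2_dot v w.
Proof.
move=> moment2 a0 Gv.
have [->|v0] := eqVneq v 0.
  rewrite (bilin0l dotP) mulr0.
  exact: bilin0l (covariance_form_symmetric_bilinear moment2) _.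
have bI : is_bochner_integral mu (fun u => L2_dot u v *: u) (a *: v).
  rewrite -Gv; have : covariance_op mu v != 0 by rewrite Gv scaler_eq0 negb_or a0.
  by rewrite /covariance_op /bochner_integral; case: xgetP => [//|_ /eqP].
have fE u : L2_dot (L2_dot u v *: u) w = L2_dot u v * L2_dot u w.
  by rewrite (bilinZl dotP).
rewrite -(bilinZl dotP) -(bochner_integral_dot bI).
  by apply: eq_Rintegral => u _; rewrite fE.
apply: (eq_integrable _ _ _ _ (covariance_form_integrable moment2 v w)) => //.
by move=> u _; rewrite /= fE.
Qed.

(** * The lower bound for the mean square error *)

(** The bound for finitely many eigenvalues. They are taken nonzero because [eigenvalue_sequence]
    supplies eigenvectors for nonzero eigenvalues only. *)
Lemma ge_encoding_mse (mu : probability (L2 nu) R) (lam : nat -> R)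
    (m N : nat) (Enc : L2 nu -> 'rV[R]_m) (Dec : {linear 'rV[R]_m -> L2 nu}) :
  (\int[mu]_u (`|u| ^+ 2)%:E < +oo)%E ->
  eigenvalue_sequence (covariance_op mu) lam ->
  (forall k, (k < N)%N -> lam k != 0) -> (m <= N)%N ->
  ((\sum_(m <= k < N) lam k)%:E <=
    \int[mu]_u (`|Dec (Enc u) - u| ^+ 2)%:E)%E.
Proof.
move=> moment2 [dlam _ dimG] lam0 mN.
have CP := covariance_form_symmetric_bilinear moment2.
have GC a v w := covariance_op_eigenvector w moment2 (a := a) (v := v).
have [e oe Ge] := exists_orthonormal_eigenvectors
  dotP L2_dot_ge0 L2_dot_eq0 CP GC dimG lam0.
have Nm : (N - m + m <= N)%N by rewrite subnK.
have [z [oz ze zDec]] := orthonormal_avoiding dotP L2_dot_ge0 L2_dot_eq0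
  (fun i : 'I_m => Dec 'e_i) oe Nm.
have le_form : \sum_(m <= k < N) lam k <=
    \sum_(j < N - m) covariance_form mu (z j) (z j).
  apply: (ge_sum_quadratic_form dotP L2_dot_ge0 CP _ oe) => //.
  by move=> k w kN; apply: GC; [exact: lam0|exact: Ge].
(* The [m] vectors [Dec 'e_i] span the range of the decoder; this is where its linearity enters. *)
have Dz c j : (j < N - m)%N -> L2_dot (Dec c) (z j) = 0.
  move=> jN; rewrite (row_sum_delta c) linear_sum.
  under eq_bigr do rewrite linearZ.
  rewrite (bilin_suml dotP) big1// => i _.
  by rewrite (bilinC dotP) zDec// mulr0.
rewrite (le_trans (y := (\sum_(j < N - m) covariance_form mu (z j) (z j))%:E))//.
have intz (j : nat) := covariance_form_integrable moment2 (z j) (z j).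
rewrite -sumEFin.
have covE (j : nat) : (covariance_form mu (z j) (z j))%:E =
    (\int[mu]_u (L2_dot u (z j) * L2_dot u (z j))%:E)%E.
  rewrite /covariance_form /Rintegral fineK//.
  by apply: integrable_fin_num => //; exact: intz.
under eq_bigr do rewrite covE.
rewrite -integral_sum//; last by move=> j; exact: intz.
apply: ge0_le_integralT => u.
  by rewrite sume_ge0// => j _; rewrite lee_fin -expr2 sqr_ge0.
rewrite sumEFin lee_fin -L2_dot_sqr.
apply: le_trans (bessel dotP L2_dot_ge0 (Dec (Enc u) - u) oz).
apply: ler_sum => j _.
by rewrite (bilinBl dotP) Dz// sub0r sqrrN expr2.
Qed.

End L2_inner_product.

(* The eigenvalues are indexed from 0: [lam k] is the (k+1)-st one. *)
Theorem theorem3p8 (R : realType) (d : nat) (D : set 'rV[R]_d)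
    (cD : compact D)
    (mu : probability (L2 (lebesgue_on cD)) R)
    (mu_moment2 : (\int[mu]_u (`|u| ^+ 2)%:E < +oo)%E)
    (mu_mean0 : is_bochner_integral mu (fun u : L2 (lebesgue_on cD) => u) 0)
    (lam : nat -> R)
    (lamP : eigenvalue_sequence (covariance_op mu) lam)
    (m : nat)
    (Enc : L2 (lebesgue_on cD) -> 'rV[R]_m)
    (mEnc : measurable_fun [set: L2 (lebesgue_on cD)] Enc)
    (Dec : {linear 'rV[R]_m -> L2 (lebesgue_on cD)}) :
  (\sum_(m <= k <oo) (lam k)%:E <=
     \int[mu]_u (`|Dec (Enc u) - u| ^+ 2)%:E)%E /\
  (sqrte (\sum_(m <= k <oo) (lam k)%:E) <= encoding_error mu Enc Dec)%E.
Proof.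
have int_ge0 : (0 <= \int[mu]_u (`|Dec (Enc u) - u| ^+ 2)%:E)%E.
  by apply: integral_ge0 => u _; rewrite lee_fin sqr_ge0.
have [dlam lam_ge0 _] := lamP.
suff le_mse : (\sum_(m <= k <oo) (lam k)%:E <=
    \int[mu]_u (`|Dec (Enc u) - u| ^+ 2)%:E)%E.
  by split=> //; rewrite /encoding_error lee_sqrt.
(* The series is the limit of its partial sums, so it is enough to bound each of them. *)
apply: lime_le; first by apply: is_cvg_nneseries => k _ _; rewrite lee_fin.
apply: nearW; elim=> [|N ih]; first by rewrite big_geq.
have [mN|Nm] := leqP m N; last by rewrite big_geq.
(* If the last term vanishes, the sum is the previous one and [ih] applies. Otherwise all earlier
   eigenvalues are positive too, by monotonicity, and the finite bound applies with [N.+1]. *)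
have [lamN|lamN] := eqVneq (lam N) 0.
  by rewrite big_nat_recr//= lamN adde0.
rewrite sumEFin; apply: ge_encoding_mse => //; last exact: leqW.
move=> k; rewrite ltnS => kN; rewrite gt_eqF//.
by rewrite (lt_le_trans _ (dlam _ _ kN))// lt_neqAle eq_sym lamN lam_ge0.
Qed.
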